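(* Let $q=2^n>2$, let $P$ be the point set of $PG(3,q)$, and let $G=PSp(4,q)$ be the projective symplectic group defined by $W(q)$. Let $\mathcal{C}$ and $\mathcal{D}$ be the $\mathbb{F}_2G$-submodules of $\mathbb{F}_2^P$ generated by, respectively, the lines of $W(q)$ and the dual grids of $W(q)$. Then $\mathcal{D}$ is properly contained in the dual code $\mathcal{C}^{\perp}$, i.e. $\mathcal{D}\subsetneq\mathcal{C}^{\perp}$.
   Context: Fix a nondegenerate symplectic (alternating) bilinear form on $\mathbb{F}_q^4$. $W(q)$ is the symplectic generalized quadrangle whose points are all points of $PG(3,q)$ and whose lines are the lines of $PG(3,q)$ that are totally isotropic for this form. For a line $m$ of $PG(3,q)$, $m^{\perp}$ is the line of points orthogonal to all points of $m$. A dual grid of $W(q)$ is a subset of $P$ of the form $m\cup m^{\perp}$, where $m$ is a line of $PG(3,q)$ that is not a line of $W(q)$. The group $G$ is the subgroup $PSp(4,q)$ of $PGL(4,q)$ preserving the form. $\mathbb{F}_2^P$ is the $\mathbb{F}_2G$-permutation module on $P$; a subset of $P$ is identified with its characteristic function in $\mathbb{F}_2^P$. $\mathcal{C}^{\perp}$ is the dual of the code $\mathcal{C}$ with respect to the standard dot product on $\mathbb{F}_2^P$. *)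

(* Defs.v *)
From HB Require Import structures.
From mathcomp Require Import all_boot all_fingroup all_algebra.

Set Implicit Arguments.
Unset Strict Implicit.
Unset Printing Implicit Defensive.

Import GRing.Theory.
Local Open Scope ring_scope.

Section FiniteSubspaces.
Import VectorInternalTheory.
HB.instance Definition _ (F : finFieldType) (vT : vectType F) :=
  [Countable of {vspace vT} by <:].
HB.instance Definition _ (F : finFieldType) (vT : vectType F) :=
  [Finite of {vspace vT} by <:].
End FiniteSubspaces.

Section BinaryPermutationModule.

Variable T : finType.
Implicit Types (f g : {ffun T -> ('F_2)^o}) (A : {set T}) (S : {set {set T}}).

Definition charfun A : {ffun T -> ('F_2)^o} := [ffun x => (x \in A)%:R].

Definition ffun_perm f (s : {perm T}) : {ffun T -> ('F_2)^o} :=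
  [ffun x => f ((s^-1)%g x)].

Definition submodule (G : {group {perm T}})
    (W : {vspace {ffun T -> ('F_2)^o}}) : bool :=
  [forall s in G, forall f, (f \in W) ==> (ffun_perm f s \in W)].

Definition generated_submodule (G : {group {perm T}}) S :
    {vspace {ffun T -> ('F_2)^o}} :=
  (\bigcap_(W | submodule G W && [forall A in S, charfun A \in W]) W)%VS.

Definition dotprod f g : 'F_2 := \sum_x f x * g x.

Fact dotprod_bilinear :
  bilinear_for (GRing.Scale.Law.clone _ _ *%R _)
    (GRing.Scale.Law.clone _ _ (idfun \; *%R) _) dotprod.
Proof.
split=> [h|h] a f g /=; rewrite /dotprod mulr_sumr -big_split /=;
  apply: eq_bigr => x _; rewrite !ffunE; first by rewrite mulrDl -mulrA.
by rewrite mulrDr; congr (_ + _); apply: mulrCA.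
Qed.

HB.instance Definition _ := bilinear_isBilinear.Build _ _ _ _ _ _ dotprod
  dotprod_bilinear.

Fact dotprod_sym f g : dotprod f g = (-1) ^+ false * idfun (dotprod g f).
Proof. by rewrite mul1r; apply: eq_bigr => x _; rewrite mulrC. Qed.

HB.instance Definition _ := isHermitianSesquilinear.Build _ _ false idfun
  dotprod dotprod_sym.

Definition dual_code (W : {vspace {ffun T -> ('F_2)^o}}) :
    {vspace {ffun T -> ('F_2)^o}} := orthov dotprod W.

Lemma generated_submoduleP (G : {group {perm T}}) S :
  [/\ submodule G (generated_submodule G S),
      {in S, forall A, charfun A \in generated_submodule G S}
    & forall W, submodule G W -> {in S, forall A, charfun A \in W} ->
        (generated_submodule G S <= W)%VS].
Proof.
have genP f : reflect (forall W, submodule G W ->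
      {in S, forall A, charfun A \in W} -> f \in W)
    (f \in generated_submodule G S).
  rewrite memvE; apply: (iffP subv_bigcapP) => gf W.
    by move=> GW SW; rewrite memvE gf// GW; apply/forall_inP.
  by case/andP=> GW /forall_inP SW; rewrite -memvE gf.
split=> [|A SA|W GW SW]; last by apply/subvP=> f /genP; apply.
  apply/forall_inP=> s Gs; apply/forallP=> f; apply/implyP=> /genP gf.
  apply/genP=> W GW SW; have /forall_inP/(_ s Gs)/forallP/(_ f) := GW.
  by rewrite gf.
by apply/genP=> W _; apply.
Qed.

End BinaryPermutationModule.

Section SymplecticQuadrangle.

Variable F : finFieldType.

Definition point := {p : {vspace 'rV[F]_4} | \dim p == 1%N}.

Definition mx_lfun (g : {'GL_4[F]}) : 'End('rV[F]_4) :=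
  linfun (mulmxr (GLval g)).

Fact mx_lfunE g v : mx_lfun g v = v *m GLval g.
Proof. by rewrite lfunE. Qed.

Fact lker_mx_lfun g : lker (mx_lfun g) = 0%VS.
Proof.
apply/eqP/lker0P=> u v; rewrite !mx_lfunE => /(congr1 (mulmx^~ (invmx g))).
by rewrite !mulmxK ?GL_unitmx.
Qed.

Fact point_act_subproof (p : point) g : \dim (mx_lfun g @: val p)%VS == 1%N.
Proof. by rewrite limg_dim_eq ?lker_mx_lfun ?capv0 ?(valP p). Qed.

Definition point_act (p : point) (g : {'GL_4[F]}) : point :=
  Sub (mx_lfun g @: val p)%VS (point_act_subproof p g).

Fact point_act1 p : point_act p 1%g = p.
Proof.
apply: val_inj; rewrite /= -[RHS]lim1g; congr lfun_img.
by apply/lfunP=> v; rewrite mx_lfunE id_lfunE mulmx1.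
Qed.

Fact point_actM p : act_morph point_act p.
Proof.
move=> g h; apply: val_inj; rewrite /= -limg_comp; congr lfun_img.
by apply/lfunP=> v; rewrite comp_lfunE !mx_lfunE mulmxA.
Qed.

Canonical point_action := TotalAction point_act1 point_actM.

Variable form : {skew_symmetric 'rV[F]_4}.

Definition Sp4 : {set {'GL_4[F]}} :=
  [set g : {'GL_4[F]} | [forall u : 'rV[F]_4, forall v : 'rV[F]_4,
     form (u *m GLval g) (v *m GLval g) == form u v]].

Fact Sp4_group_set : group_set Sp4.
Proof.
apply/group_setP; split=> [|g h].
  by rewrite inE; apply/'forall_'forall_eqP=> u v; rewrite !mulmx1.
rewrite !inE => /'forall_'forall_eqP gP /'forall_'forall_eqP hP.
by apply/'forall_'forall_eqP=> u v; rewrite !mulmxA hP gP.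
Qed.

Canonical Sp4_group := Group Sp4_group_set.

(* PGL(4,q) acts faithfully on the points, so PSp(4,q) is realised as the group
   of permutations of the points induced by Sp(4,q). *)
Definition PSp4 : {group {perm point}} :=
  (actperm point_action @* Sp4)%G.

Definition points_of (m : {vspace 'rV[F]_4}) : {set point} :=
  [set p | (val p <= m)%VS].

Definition totally_isotropic (m : {vspace 'rV[F]_4}) : bool :=
  (m <= orthov form m)%VS.

Definition W_lines : {set {set point}} :=
  [set points_of m | m : {vspace 'rV[F]_4}
     & (\dim m == 2%N) && totally_isotropic m].

Definition dual_grids : {set {set point}} :=
  [set points_of m :|: points_of (orthov form m) | m : {vspace 'rV[F]_4}
     & (\dim m == 2%N) && ~~ totally_isotropic m].

Definition line_code := generated_submodule PSp4 W_lines.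

Definition dual_grid_code := generated_submodule PSp4 dual_grids.

End SymplecticQuadrangle.

(* Main.v *)
From HB Require Import structures.
Require Import Defs.
From mathcomp Require Import all_boot all_fingroup all_algebra.
From mathcomp Require Import finfield ring zify.

(** Write q = #|F|. A line of W(q) that meets m also meets m^perp: if it passes
through w in m, and w' spans m together with w, then some point of it is
orthogonal to w', hence to m, as all its points are orthogonal to w. By symmetry a line of W(q) meets both or neither
of m and m^perp, and since every nonempty projective subspace has an odd number
of points it meets the dual grid in an even number of points. Thus D is
contained in the dual of C (dual_grid_code_sub).

The inclusion is strict because there are two functions f and g on the points,
with values in F, such that f sums to 0 over every dual grid, g sums to 0 over
every line of W(q), and the sum of f g over all points is 1. Indeed, if D were
the dual of C, the coordinates of g in a basis of F over the prime field would
be words of D, hence orthogonal to f, and f g would sum to 0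
(dual_generated_pairing).

To build f and g, fix a symplectic basis a, b, c, d, put
  y(v) = <v, a> <v, b>,   Q(v) = y(v) + <v, c> <v, d>
and take
  f = y Q^(q-2) + y^2 Q^(q-3),   g = Q y^(q-2).
Both are homogeneous of degree 2(q-1), so they are functions of points, and the
exponent q-3 is where q > 2 is needed. The form itself is the polarization of Q,
and the polarization p of y is a Pluecker coordinate. The sums over lines follow
from one principle (sum_digit_forms): a product of quadratic forms A_i^(2^i), for
i < n, summed over the line through u and v, gives the product of the
P_i(u, v)^(2^i), where P_i is the polarization of A_i. Indeed only the monomial
(st)^(q-1) contributes to a sum over the coefficients s, t, and the expansion of
q-1 with binary digits in {0, 1, 2} is unique. So:
  - g sums to <u, v> p(u, v)^(q-2), which is 0 on a totally isotropic line
    (sum_codeword_isotropic);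
  - f sums to p + p^2 over a line with <u, v> = 1. If u', v' is such a basis of
    the orthogonal line, expanding <a, b> = 1 in the basis u, v, u', v' yields
    p(u, v) + p(u', v') = 1, and p + p^2 is invariant under p |-> 1 + p
    (sum_grid_functional_orthov);
  - f g = (Q y)^(q-1) + Q^(q-2) y^q sums to 1, as only the monomial with all
    four exponents equal to q-1 contributes (sum_grid_functional_codeword).

All sums over points are computed as sums over vectors: each point carries
q-1 nonzero vectors, an odd number (sum_points_of). *)

Set Implicit Arguments.
Unset Strict Implicit.
Unset Printing Implicit Defensive.

Import GRing.Theory.
Local Open Scope ring_scope.

(** * Power sums over a finite field *)

Section PowerSums.

Variable F : finFieldType.

Lemma card_field_eq0 : #|F|%:R = 0 :> F.
Proof.
have [p _ pF] := finPcharP F.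
have cardF : #|F| = (p ^ logn p #|pPrimeCharType pF|)%N.
  exact: (card_pprimeChar pF).
have := finNzRing_gt1 F; rewrite cardF.
by case: (logn _ _) => // k _; rewrite expnS natrM (pcharf0 pF) mul0r.
Qed.

Lemma expf_card1 (x : F) : x != 0 -> x ^+ #|F|.-1 = 1.
Proof.
move=> nzx; apply: (mulfI nzx); rewrite -exprS prednK ?mulr1 ?expf_card //.
by rewrite ltnW ?finNzRing_gt1.
Qed.

(** For k = 0 the sum is q = 0. Otherwise, substituting c x for x multiplies it
by c^k, and some nonzero c has c^k <> 1 since X^k - 1 has fewer than q-1
roots. *)
Lemma sum_pow_lt k : (k < #|F|.-1)%N -> \sum_(x : F) x ^+ k = 0.
Proof.
case: k => [_|k ltk].
  by under eq_bigr do rewrite expr0; rewrite sumr_const card_field_eq0.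
have [c nzc ck1] : exists2 c : F, c != 0 & c ^+ k.+1 != 1.
  have [/existsP[c /andP[nzc ck]]|/existsPn allroot] :=
    boolP [exists c : F, (c != 0) && (c ^+ k.+1 != 1)]; first by exists c.
  have nzP : 'X^(k.+1) - 1%:P != 0 :> {poly F} by rewrite -size_poly_eq0 size_XnsubC.
  have := @max_poly_roots _ _ (enum (predC1 (0 : F))) nzP.
  rewrite size_XnsubC // -cardE cardC1 enum_uniq !ltnS [(_ <= k.+1)%N]leqNgt ltk.
  move=> maxr; suff: false by []; apply: maxr => //.
  apply/allP=> x; rewrite mem_enum => nzx.
  have := allroot x; rewrite -topredE /= in nzx; rewrite nzx negbK => /eqP xk.
  by rewrite /root !hornerE xk subrr.
apply/eqP; have := ck1; apply: contraNT => nzS.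
suff: (c ^+ k.+1 - 1) * (\sum_x x ^+ k.+1) == 0.
  by rewrite mulf_eq0 subr_eq0 (negPf nzS) orbF.
rewrite mulrBl mul1r subr_eq0 mulr_sumr; apply/eqP.
rewrite [RHS](reindex_inj (mulfI nzc)) /=.
by apply: eq_bigr => x _; rewrite exprMn.
Qed.

Lemma sum_pow_card1 : \sum_(x : F) x ^+ #|F|.-1 = -1.
Proof.
have pq : (0 < #|F|.-1)%N by rewrite -subn1 subn_gt0 finNzRing_gt1.
rewrite (bigD1 0) //= expr0n eqn0Ngt pq add0r.
under eq_bigr => x nzx do rewrite expf_card1 //.
rewrite sumr_const (cardC1 (0 : F)); apply/eqP.
by rewrite -subr_eq0 opprK -mulrSr prednK ?card_field_eq0 // ltnW ?finNzRing_gt1.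
Qed.

End PowerSums.

(** * Sums of products of quadratic forms over a line *)

(** The parity of the sum forces the lowest digit to be 1; divide by 2 and
recurse. *)
Lemma digits_of_pow2_sub1 n (e : 'I_n -> nat) :
  (forall i, e i <= 2)%N ->
  (\sum_(i < n) 2 ^ i * e i = 2 ^ n - 1)%N -> forall i, e i = 1%N.
Proof.
elim: n e => [e _ _ []//|n IHn e le2].
rewrite big_ord_recl expn0 mul1n /=.
under eq_bigr => i _ do rewrite /bump /= add1n expnS -mulnA.
rewrite -big_distrr /= => sumE.
have pos : (0 < 2 ^ n)%N by rewrite expn_gt0.
move: sumE; rewrite expnS; set s := (\sum_(i < n) _)%N => sumE.
have e0 : e ord0 = 1%N by have := le2 ord0; lia.
have /IHn IH : s = (2 ^ n - 1)%N by lia.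
move=> i; have [j ->|->//] := unliftP ord0 i.
exact: IH.
Qed.

Section LineSums.

Variables (n : nat) (F : finFieldType).
Hypothesis card_F : #|F| = (2 ^ n)%N.

Let char2 : 2 \in [pchar F]. Proof. exact: card_finPcharP card_F _. Qed.

(** The 2^i-th power is additive, so the product expands into monomials
s^a t^b with a + b = 2(q-1). Unless a = b = q-1, one of the exponents is less
than q-1 and its power sum vanishes; and a = b = q-1 forces the middle
coefficient to be chosen in each factor. *)
Lemma sum_digit_forms (c : 'I_n -> 'I_3 -> F) :
  \sum_(s : F) \sum_(t : F)
     \prod_i (\sum_k c i k * (s ^+ (2 - k) * t ^+ k)) ^+ (2 ^ i)
  = \prod_i c i (inord 1) ^+ (2 ^ i).
Proof.
have frob m (x : 'I_3 -> F) :
    (\sum_k x k) ^+ (2 ^ m) = \sum_k x k ^+ (2 ^ m).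
  elim: m x => [|m IHm] x; first by rewrite expn0; apply: eq_bigr.
  rewrite expnS exprM -(pFrobenius_autE char2) raddf_sum /= IHm.
  by apply: eq_bigr => k _; rewrite pFrobenius_autE -exprM.
(* e i says which of s^2, st, t^2 is chosen in the i-th factor. *)
pose a (e : {ffun 'I_n -> 'I_3}) := (\sum_(i < n) 2 ^ i * (2 - e i))%N.
pose b (e : {ffun 'I_n -> 'I_3}) := (\sum_(i < n) 2 ^ i * e i)%N.
have sum2 : (\sum_(i < n) 2 ^ i = 2 ^ n - 1)%N.
  by rewrite subn1 predn_exp mul1n.
have abE e : (a e + b e = (2 ^ n - 1) + (2 ^ n - 1))%N.
  rewrite -big_split /= -sum2 -big_split /=; apply: eq_bigr => i _.
  by rewrite -mulnDr subnK ?muln2 ?addnn // -ltnS.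
have expand s t : \prod_i (\sum_k c i k * (s ^+ (2 - k) * t ^+ k)) ^+ (2 ^ i)
  = \sum_(e : {ffun 'I_n -> 'I_3})
      (\prod_i c i (e i) ^+ (2 ^ i)) * (s ^+ a e * t ^+ b e).
  under eq_bigr do rewrite frob.
  rewrite bigA_distr_bigA /=; apply: eq_bigr => e _.
  rewrite /a /b -!prodrXr -!big_split /=; apply: eq_bigr => i _.
  by rewrite !exprMn -!exprM ![(_ * 2 ^ i)%N]mulnC.
rewrite (eq_bigr _ (fun s _ => eq_bigr _ (fun t _ => expand s t))).
under eq_bigr => s _ do rewrite exchange_big /=.
rewrite exchange_big /=.
have termE (e : {ffun 'I_n -> 'I_3}) : \sum_(s : F) \sum_(t : F)
      (\prod_i c i (e i) ^+ (2 ^ i)) * (s ^+ a e * t ^+ b e) =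
    (\prod_i c i (e i) ^+ (2 ^ i)) *
    ((\sum_(s : F) s ^+ a e) * (\sum_(t : F) t ^+ b e)).
  rewrite mulr_suml mulr_sumr; apply: eq_bigr => s _.
  by rewrite !mulr_sumr.
under eq_bigr => e _ do rewrite termE.
have pow0 k : (k < 2 ^ n - 1)%N -> \sum_(x : F) x ^+ k = 0.
  by move=> ltk; rewrite sum_pow_lt // card_F -subn1.
rewrite (bigD1 [ffun=> inord 1]) //= [X in _ + X]big1 ?addr0 => [|e e_neq].
  have e1 : forall i : 'I_n, ([ffun=> inord 1] : {ffun 'I_n -> 'I_3}) i = 1%N :> nat.
    by move=> i; rewrite ffunE inordK.
  have ->: a [ffun=> inord 1] = #|F|.-1.
    by rewrite card_F -subn1 -sum2; apply: eq_bigr => i _; rewrite e1 muln1.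
  have ->: b [ffun=> inord 1] = #|F|.-1.
    by rewrite card_F -subn1 -sum2; apply: eq_bigr => i _; rewrite e1 muln1.
  rewrite sum_pow_card1 mulrNN !mulr1.
  by apply: eq_bigr => i _; rewrite ffunE.
have [lta|gea] := ltnP (a e) (2 ^ n - 1); first by rewrite (pow0 _ lta) mul0r mulr0.
have [ltb|geb] := ltnP (b e) (2 ^ n - 1).
  by rewrite (pow0 _ ltb) !mulr0.
case/eqP: e_neq; apply/ffunP=> i; rewrite ffunE; apply/val_inj.
rewrite /= inordK //; apply: (@digits_of_pow2_sub1 n (fun i => e i)) => [j|].
  by rewrite -ltnS.
by have := abE e; rewrite -/(b e); lia.
Qed.

(** The case of [sum_digit_forms] in which all the quadratic forms but the j-th
one coincide. *)
Lemma sum_digit_pow j (a0 a1 a2 b0 b1 b2 : F) : (j < n)%N ->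
  \sum_(s : F) \sum_(t : F)
     (a0 * s ^+ 2 + a1 * (s * t) + a2 * t ^+ 2) ^+ (2 ^ j) *
     (b0 * s ^+ 2 + b1 * (s * t) + b2 * t ^+ 2) ^+ (2 ^ n - 1 - 2 ^ j)
  = a1 ^+ (2 ^ j) * b1 ^+ (2 ^ n - 1 - 2 ^ j).
Proof.
move=> ltjn; pose j' := Ordinal ltjn.
have prodE (x y : F) :
    x ^+ (2 ^ j) * y ^+ (2 ^ n - 1 - 2 ^ j) =
    \prod_(i < n) (if i == j' then x else y) ^+ (2 ^ i).
  rewrite (bigD1 j') //= eqxx; congr (_ * _).
  have -> : (2 ^ n - 1 - 2 ^ j = \sum_(i < n | i != j') 2 ^ i)%N.
    by rewrite [in LHS]subn1 predn_exp mul1n (bigD1 j') //= addKn.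
  by rewrite -prodrXr; apply: eq_bigr => i /negPf->.
pose c (i : 'I_n) (k : 'I_3) :=
  if i == j' then [:: a0; a1; a2]`_k else [:: b0; b1; b2]`_k.
transitivity (\prod_i c i (inord 1) ^+ (2 ^ i)); last first.
  by rewrite prodE; apply: eq_bigr => i _; rewrite /c inordK.
rewrite -sum_digit_forms; apply: eq_bigr => s _; apply: eq_bigr => t _.
rewrite prodE; apply: eq_bigr => i _; congr (_ ^+ _).
by rewrite /c; case: (i == j');
  rewrite !big_ord_recl big_ord0 /= !expr0 !expr1 mulr1 mul1r addr0 addrA.
Qed.

End LineSums.

(** * Sums over lines and over points *)

Section Vectors.

Variables (F : finFieldType).
Local Notation V := 'rV[F]_4.

Lemma dim2_basis (m : {vspace V}) : \dim m = 2%N ->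
  exists u v, free [:: u; v] /\ m = <<[:: u; v]>>%VS.
Proof.
move=> dim_m; have := basis_free (vbasisP m); have := span_basis (vbasisP m).
have := size_tuple (vbasis m); rewrite {2}dim_m.
by case: (tval (vbasis m)) => [|u [|v []]] //= _ <- fr; exists u, v.
Qed.

Lemma mem_span2P (u v w : V) :
  reflect (exists s t, w = s *: u + t *: v) (w \in <<[:: u; v]>>%VS).
Proof.
rewrite span_cons span_seq1; apply: (iffP memv_addP) => [[x /vlineP[s ->]]|].
  by case=> _ /vlineP[t ->] ->; exists s, t.
case=> s [t ->]; exists (s *: u); first by rewrite memvZ ?memv_line.
by exists (t *: v) => //; rewrite memvZ ?memv_line.
Qed.

Lemma free2P (u v : V) :
  reflect (forall s t, s *: u + t *: v = 0 -> s = 0 /\ t = 0) (free [:: u; v]).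
Proof.
apply: (iffP (@freeP F _ 2 [tuple u; v])) => [fr s t st0|fr k].
  pose k (i : 'I_2) := if i == ord0 then s else t.
  have k0 : forall i, k i = 0 by apply: fr; rewrite !big_ord_recl big_ord0 addr0.
  by split; [apply: (k0 ord0) | apply: (k0 (lift ord0 ord0))].
rewrite !big_ord_recl big_ord0 addr0 /= => /fr[k0 k1] i.
by case: (unliftP ord0 i) => [j ->|->//]; rewrite (ord1 j).
Qed.

Lemma sum_span2 (R : nmodType) (h : V -> R) (u v : V) : free [:: u; v] ->
  \sum_(w in <<[:: u; v]>>%VS) h w = \sum_s \sum_t h (s *: u + t *: v).
Proof.
move=> /free2P fr; pose phi (x : F * F) := x.1 *: u + x.2 *: v.
have inj_phi : injective phi.
  move=> [s t] [s' t'] /eqP; rewrite -subr_eq0 /phi /= opprD addrACA -!scalerBl.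
  by move=> /eqP/fr[/eqP + /eqP]; rewrite !subr_eq0 => /eqP-> /eqP->.
rewrite pair_big /= -(big_imset h (in2W inj_phi)); apply: eq_bigl => w.
apply/mem_span2P/imsetP => [[s [t ->]]|[[s t] _ ->]]; last by exists s, t.
by exists (s, t).
Qed.

(** A point carries q-1 nonzero vectors, and q-1 is 1 in characteristic 2. *)
Lemma sum_points_of (h : V -> F) (U : {vspace V}) : 2 \in [pchar F] ->
  h 0 = 0 -> (forall c v, c != 0 -> h (c *: v) = h v) ->
  \sum_(p in points_of U) h (vpick (val p)) = \sum_(v in U) h v.
Proof.
move=> char2 h0 hZ.
have nz0 : delta_mx 0 0 != 0 :> V.
  by apply/eqP=> /matrixP/(_ 0 0)/eqP; rewrite !mxE eqxx oner_eq0.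
have dim0 : \dim <[delta_mx 0 0 : V]> == 1%N by rewrite dim_vline nz0.
(* The default value of pt is taken at v = 0 only, where h vanishes. *)
pose pt (v : V) : point F := insubd (Sub <[_]>%VS dim0 : point F) <[v]>%VS.
have ptE v : v != 0 -> val (pt v) = <[v]>%VS.
  by move=> nzv; rewrite val_insubd dim_vline nzv.
rewrite [RHS](bigID (fun v => v == 0)) [X in _ = X + _]big1 ?add0r; last first.
  by move=> v /andP[_ /eqP->].
rewrite (partition_big pt [in points_of U]) /=; last first.
  by move=> v /andP[Uv nzv]; rewrite inE ptE // -memvE.
apply: eq_bigr => p; rewrite inE => sub_pU.
have nzp : vpick (val p) != 0.
  by rewrite vpick0 -dimv_eq0 (eqP (valP p)).
have pE : val p = <[vpick (val p)]>%VS.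
  apply/eqP; rewrite eq_sym eqEdim (eqP (valP p)) dim_vline nzp leqnn andbT.
  by rewrite -memvE memv_pick.
transitivity (\sum_(c : F | c != 0) h (c *: vpick (val p))).
  under eq_bigr => c nzc do rewrite hZ //.
  rewrite sumr_const (cardC1 (0 : F)) -mulr_natl -{1}[h _]mul1r; congr (_ * _).
  have := card_field_eq0 F; rewrite -(prednK (ltnW (finNzRing_gt1 F))) mulrSr.
  by move/eqP; rewrite addr_eq0 (oppr_pchar2 char2) => /eqP.
rewrite -(big_imset h) /=; last first.
  by move=> c c' _ _ /eqP; rewrite -subr_eq0 -scalerBl scaler_eq0 (negPf nzp) orbF
    subr_eq0 => /eqP.
apply: eq_bigl => v; apply/imsetP/andP=> [[c nzc ->]|[/andP[Uv nzv] /eqP ptv]].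
  rewrite -topredE /= in nzc; rewrite scaler_eq0 negb_or nzc nzp; split.
    by rewrite andbT memvZ //; move: sub_pU; rewrite pE -memvE.
  apply/eqP/val_inj; rewrite ptE ?scaler_eq0 ?negb_or ?nzc //= [RHS]pE.
  apply/eqP; rewrite eqEdim !dim_vline scaler_eq0 negb_or nzc nzp andbT.
  by rewrite -memvE memvZ ?memv_line.
have /vlineP[c vE] : v \in <[vpick (val p)]>%VS.
  by rewrite -pE -ptv ptE // memv_line.
exists c => //; rewrite -topredE /=; apply: contraNneq nzv => c0.
by rewrite vE c0 scale0r.
Qed.

End Vectors.

(** * Symplectic bases in characteristic 2 *)

Section Symplectic.

Variables (F : finFieldType) (form : {skew_symmetric 'rV[F]_4}).
Local Notation V := 'rV[F]_4.
Hypothesis char2 : 2 \in [pchar F].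
Hypothesis form_alt : forall u : V, form u u = 0.
Hypothesis form_nondeg : nondegenerate form.

Lemma formC2 u v : form u v = form v u.
Proof. by rewrite hermC expr1 mulN1r (oppr_pchar2 char2). Qed.

Definition symplectic_basis a b c d :=
  [/\ form a b = 1, form c d = 1 &
    [/\ form a c = 0, form a d = 0, form b c = 0 & form b d = 0]].

Definition formE :=
  (linearDl, linearDr, linearZl_LR, linearZr_LR).

Lemma symplectic_basis_sym a b c d :
  symplectic_basis a b c d -> symplectic_basis c d a b.
Proof.
by case=> ab cd [ac ad bc bd]; split=> //; split; rewrite formC2.
Qed.

Section Basis.

Variables a b c d : V.
Hypothesis sb : symplectic_basis a b c d.

Definition comb4 (x : F * F * (F * F)) : V :=
  (x.1.1 *: a + x.1.2 *: b) + (x.2.1 *: c + x.2.2 *: d).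

Definition coord4 (v : V) : F * F * (F * F) :=
  ((form v b, form v a), (form v d, form v c)).

Lemma comb4K : cancel comb4 coord4.
Proof.
case: sb => ab cd [ac ad bc bd] [[s t] [u v]].
have [[ba dc] ca] := (formC2 b a, formC2 d c, formC2 c a).
have [[da cb] db] := (formC2 d a, formC2 c b, formC2 d b).
rewrite /coord4 /comb4 /= !formE /=.
rewrite !form_alt ba dc ca da cb db ab cd ac ad bc bd.
by rewrite !mulr0 !mulr1 !addr0 !add0r.
Qed.

(** The pairings recover the coefficients, so [comb4] is injective; both sides
have q^4 elements. *)
Lemma comb4_bij : bijective comb4.
Proof.
apply: inj_card_bij (can_inj comb4K) _.
by rewrite card_mx !card_prod mul1n !expnS expn0 !mulnA muln1.
Qed.

Lemma symplectic_expansion v :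
  v = (form v b *: a + form v a *: b) + (form v d *: c + form v c *: d).
Proof. by rewrite {1}(esym ((bij_can_sym comb4_bij coord4).2 comb4K v)). Qed.

Lemma form_expansion u v :
  form u v = (form u a * form v b + form u b * form v a)
           + (form u c * form v d + form u d * form v c).
Proof.
rewrite {1}[v]symplectic_expansion !linearDr !linearZr_LR /=.
by rewrite ![_ * form u _]mulrC.
Qed.

Lemma sum_comb4 (h : V -> F) :
  \sum_v h v = \sum_s \sum_t \sum_x \sum_y
     h ((s *: a + t *: b) + (x *: c + y *: d)).
Proof.
rewrite (reindex comb4) /=; last exact: onW_bij comb4_bij.
rewrite pair_big /=; under [RHS]eq_bigr => i _ do rewrite pair_big /=.
by rewrite pair_big.
Qed.

Lemma free_hyperbolic : free [:: a; b].
Proof.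
have [ab _ _] := sb; apply/free2P=> s t st0.
have := congr1 (form^~ a) st0; have := congr1 (form^~ b) st0.
rewrite /= !linearDl !linearZl_LR /= !form_alt [form b a]formC2 ab !linear0l.
by rewrite !mulr0 !mulr1 addr0 add0r.
Qed.

Lemma orthov_hyperbolic : orthov form <<[:: a; b]>> = <<[:: c; d]>>%VS.
Proof.
have [ab cd [ac ad bc bd]] := sb; apply/vspaceP=> v.
apply/mem_orthovP/mem_span2P => [ov|[s [t ->]] w].
  have [va vb] : form v a = 0 /\ form v b = 0.
    by split; rewrite ov ?memv_span ?inE ?eqxx ?orbT.
  exists (form v d), (form v c).
  rewrite {1}[v]symplectic_expansion.
  by rewrite va vb !scale0r addr0 add0r.
move=> /mem_span2P[x [y ->]].
rewrite !formE /= ![form _ a]formC2 ![form _ b]formC2 ac ad bc bd.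
by rewrite !mulr0 !addr0.
Qed.

End Basis.

(** The orthogonal complement of the pair is nonzero; a vector of it and
any vector not orthogonal to it, projected along the pair and rescaled, are the
two missing basis vectors. *)
Lemma exists_hyperbolic_complement a b : form a b = 1 ->
  exists c d, symplectic_basis a b c d.
Proof.
move=> ab; pose W := (orthov form <[a]> :&: orthov form <[b]>)%VS.
have dimW : (1 < \dim W)%N.
  have := leq_dim_orthov1 form a fullv; rewrite capfv => d1.
  have := leq_dim_orthov1 form b (orthov form <[a]>).
  have dimV : \dim {:V} = 4%N by rewrite dimvf.
  by rewrite -/W; move: d1; rewrite dimV; lia.
pose c := vpick W.
have nzc : c != 0 by rewrite vpick0 -dimv_eq0; case: (\dim W) dimW.
have : c \notin orthov form fullv by rewrite (eqP form_nondeg) memv0.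
case/mem_orthovPn=> e _ nz_ce.
have := memv_pick W; rewrite memv_cap !mem_orthov1 -/c => /andP[/eqP ca /eqP cb].
(* Projection of e on the orthogonal of a and b; it pairs with c as e does. *)
pose e' := e - (form e b *: a + form e a *: b).
have e'a : form e' a = 0.
  by rewrite /e' linearBl linearDl !linearZl_LR /= form_alt formC2 [form b a]formC2
    ab mulr0 add0r mulr1 subrr.
have e'b : form e' b = 0.
  by rewrite /e' linearBl linearDl !linearZl_LR /= form_alt ab mulr0 addr0 mulr1
    subrr.
have ce' : form c e' = form c e.
  by rewrite /e' linearBr linearDr !linearZr_LR /= ca cb !mulr0 addr0 subr0.
exists c, ((form c e)^-1 *: e'); split=> //.
  by rewrite linearZr_LR /= ce' mulVf.
rewrite !linearZr_LR /= ![form a _]formC2 ![form b _]formC2 ca cb e'a e'b.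
by rewrite mulr0.
Qed.

Lemma hyperbolic_line_from m a : \dim m = 2%N -> a \in m ->
  a \notin orthov form m ->
  exists b c d, symplectic_basis a b c d /\ m = <<[:: a; b]>>%VS.
Proof.
move=> dim_m am /mem_orthovPn[b0 b0m ab0]; pose b := (form a b0)^-1 *: b0.
have ab : form a b = 1 by rewrite linearZr_LR /= mulVf.
have [c [d sb]] := exists_hyperbolic_complement ab.
exists b, c, d; split=> //.
apply/eqP; rewrite eq_sym eqEdim (eqnP (free_hyperbolic sb)) dim_m leqnn andbT.
by apply/span_subvP=> v; rewrite !inE => /orP[]/eqP->; rewrite ?memvZ.
Qed.

Lemma hyperbolic_line m : \dim m = 2%N -> ~~ totally_isotropic form m ->
  exists a b c d, symplectic_basis a b c d /\ m = <<[:: a; b]>>%VS.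
Proof.
move=> dim_m /subvPn[a am a_nm].
by have [b [c [d sbm]]] := hyperbolic_line_from dim_m am a_nm; exists a, b, c, d.
Qed.

Lemma exists_symplectic_basis : exists a b c d, symplectic_basis a b c d.
Proof.
have nza : delta_mx 0 0 != 0 :> V.
  by apply/eqP=> /matrixP/(_ 0 0)/eqP; rewrite !mxE eqxx oner_eq0.
have : delta_mx 0 0 \notin orthov form fullv by rewrite (eqP form_nondeg) memv0.
move: (delta_mx _ _) nza => a nza /mem_orthovPn[b0 _ ab0].
have ab : form a ((form a b0)^-1 *: b0) = 1 by rewrite linearZr_LR /= mulVf.
have [c [d sb]] := exists_hyperbolic_complement ab.
by exists a; eexists; exists c, d; exact: sb.
Qed.

Lemma capv_orthov_hyperbolic m :
  \dim m = 2%N -> ~~ totally_isotropic form m -> (m :&: orthov form m = 0)%VS.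
Proof.
move=> dim_m /(hyperbolic_line dim_m)[a [b [c [d [sb ->]]]]].
apply/eqP; rewrite -subv0; apply/subvP=> v; rewrite memv_cap memv0.
case/andP=> vm /mem_orthovP ov; rewrite (symplectic_expansion sb v).
have [va vb] : form v a = 0 /\ form v b = 0.
  by split; rewrite ov ?memv_span ?inE ?eqxx ?orbT.
move: vm; rewrite -(orthov_hyperbolic (symplectic_basis_sym sb)) => /mem_orthovP ov'.
have [vc vd] : form v c = 0 /\ form v d = 0.
  by split; rewrite ov' ?memv_span ?inE ?eqxx ?orbT.
by rewrite va vb vc vd !scale0r !addr0.
Qed.

(** If a spans a common point of l and m, choose b in m with <a, b> = 1. Some
nonzero vector of l is orthogonal to b, and it is orthogonal to a because l is
totally isotropic. *)
Lemma isotropic_line_meets l m : \dim l = 2%N -> totally_isotropic form l ->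
  \dim m = 2%N -> ~~ totally_isotropic form m ->
  (l :&: m != 0)%VS -> (l :&: orthov form m != 0)%VS.
Proof.
move=> dim_l /orthovP ti_l dim_m nti_m; set a := vpick (l :&: m)%VS => nz_lm.
have := memv_pick (l :&: m)%VS; rewrite memv_cap -/a => /andP[al am].
have nza : a != 0 by rewrite vpick0.
have a_nm : a \notin orthov form m.
  apply: contra nza => a_om; rewrite -memv0 -(capv_orthov_hyperbolic dim_m nti_m).
  by rewrite memv_cap am.
have [b [c [d [sb mE]]]] := hyperbolic_line_from dim_m am a_nm.
have := leq_dim_orthov1 form b l; rewrite dim_l lt0n dimv_eq0.
set k := (l :&: orthov form <[b]>)%VS => nzk.
have := memv_pick k; rewrite {2}/k.
rewrite memv_cap mem_orthov1 => /andP[kl /eqP kb].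
apply: contraNneq nzk => lm0; rewrite -vpick0 -memv0 -lm0 memv_cap kl.
rewrite mE; apply/mem_orthovP=> _ /mem_span2P[s [t ->]].
by rewrite linearDr !linearZr_LR /= kb (ti_l _ _ kl al) !mulr0 addr0.
Qed.

Lemma isotropic_line_meets_both l m : \dim l = 2%N -> totally_isotropic form l ->
  \dim m = 2%N -> ~~ totally_isotropic form m ->
  ((l :&: m)%VS == 0%VS) = ((l :&: orthov form m)%VS == 0%VS).
Proof.
move=> dim_l ti_l dim_m nti_m; apply/idP/idP; apply: contraLR; last first.
  exact: isotropic_line_meets.
have [a [b [c [d [sb mE]]]]] := hyperbolic_line dim_m nti_m.
have omE := orthov_hyperbolic sb; have sb' := symplectic_basis_sym sb.
rewrite mE -[X in _ -> (_ :&: X)%VS != _](orthov_hyperbolic sb') omE.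
apply: isotropic_line_meets => //; first exact: (eqnP (free_hyperbolic sb')).
apply/negP=> /orthovP/(_ c d); rewrite !memv_span ?inE ?eqxx ?orbT //.
have [_ -> _] := sb; move=> /(_ isT isT)/eqP; exact/negP/oner_neq0.
Qed.

End Symplectic.

(** * Homogeneous functions built from quadratic forms *)

Section DigitProducts.

Variables (n : nat) (F : finFieldType).
Hypothesis card_F : #|F| = (2 ^ n)%N.
Local Notation V := 'rV[F]_4.

Definition quadratic_with (A : V -> F) (P : V -> V -> F) :=
  forall s t u v,
    A (s *: u + t *: v) = A u * s ^+ 2 + P u v * (s * t) + A v * t ^+ 2.

(** The function A^(2^j) B^(q-1-2^j), of degree 2(q-1) when A and B are
quadratic; q-1-2^j is the sum of the powers of 2 other than 2^j below q. *)
Definition digit_product j (A B : V -> F) (v : V) :=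
  A v ^+ (2 ^ j) * B v ^+ (2 ^ n - 1 - 2 ^ j).

Variables (A B : V -> F) (P R : V -> V -> F) (j : nat).
Hypotheses (quadA : quadratic_with A P) (quadB : quadratic_with B R).
Hypothesis ltjn : (j < n)%N.

Lemma quadraticZ A' P' c v : quadratic_with A' P' -> A' (c *: v) = c ^+ 2 * A' v.
Proof.
move=> /(_ c 0 v 0); rewrite scale0r addr0 => ->.
by rewrite expr0n !mulr0 !addr0 mulrC.
Qed.

Lemma digit_product0 : digit_product j A B 0 = 0.
Proof.
rewrite /digit_product -(scale0r 0) (quadraticZ _ _ quadA) expr0n mul0r expr0n.
by rewrite expn_eq0 mul0r.
Qed.

Lemma digit_productZ c v :
  c != 0 -> digit_product j A B (c *: v) = digit_product j A B v.
Proof.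
move=> nzc; rewrite /digit_product (quadraticZ _ _ quadA) (quadraticZ _ _ quadB).
rewrite [(_ * A v) ^+ _]exprMn [(_ * B v) ^+ _]exprMn mulrACA -exprD subnKC; last first.
  by have := ltn_exp2l j n (ltnSn 1); rewrite ltjn; lia.
by rewrite -exprM mulnC exprM subn1 -card_F (expf_card1 nzc) expr1n mul1r.
Qed.

Lemma sum_line_digit_product (u v : V) : free [:: u; v] ->
  \sum_(w in <<[:: u; v]>>%VS) digit_product j A B w
  = P u v ^+ (2 ^ j) * R u v ^+ (2 ^ n - 1 - 2 ^ j).
Proof.
move=> fr; rewrite sum_span2 //.
rewrite -(sum_digit_pow card_F (A u) _ (A v) (B u) _ (B v) ltjn).
by apply: eq_bigr => s _; apply: eq_bigr => t _; rewrite /digit_product quadA quadB.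
Qed.

End DigitProducts.

(** * The two functions separating the codes *)

Section Functions.

Variables (n : nat) (F : finFieldType) (form : {skew_symmetric 'rV[F]_4}).
Hypotheses (card_F : #|F| = (2 ^ n)%N) (q_gt2 : (2 < 2 ^ n)%N).
Hypothesis form_alt : forall u, form u u = 0.
Local Notation V := 'rV[F]_4.

Let char2 : 2 \in [pchar F]. Proof. exact: card_finPcharP card_F _. Qed.
Let n_gt1 : (1 < n)%N. Proof. by case: n q_gt2 => [|[]]. Qed.

Variables a b c d : V.
Hypothesis sb : symplectic_basis form a b c d.

Definition quad1 u := form u a * form u b.
Definition quad2 u := quad1 u + form u c * form u d.
Definition pol1 u v := form u a * form v b + form u b * form v a.

Lemma quad1P : quadratic_with quad1 pol1.
Proof.
by move=> s t u v; rewrite /quad1 /pol1 !linearDl !linearZl_LR /=; ring.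
Qed.

Lemma quad2P : quadratic_with quad2 form.
Proof.
move=> s t u v; rewrite /quad2 quad1P !linearDl !linearZl_LR /=.
by rewrite (form_expansion char2 form_alt sb u v) /pol1 /quad1; ring.
Qed.

(** Equal to Q^(q-3) y z with z = Q - y, in characteristic 2; this expression
makes it a sum of two digit products. *)
Definition grid_functional v :=
  digit_product n 0 quad1 quad2 v + digit_product n 1 quad1 quad2 v.

Definition codeword := digit_product n 0 quad2 quad1.

Lemma grid_functional0 : grid_functional 0 = 0.
Proof. by rewrite /grid_functional !(digit_product0 _ _ _ quad1P) addr0. Qed.

Lemma grid_functionalZ k v :
  k != 0 -> grid_functional (k *: v) = grid_functional v.
Proof.
move=> nzk; rewrite /grid_functional.
by rewrite !(digit_productZ card_F quad1P quad2P) // ltnW.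
Qed.

Lemma codeword0 : codeword 0 = 0.
Proof. exact: digit_product0 _ _ _ quad2P. Qed.

Lemma codewordZ k v : k != 0 -> codeword (k *: v) = codeword v.
Proof.
by move=> nzk; rewrite /codeword (digit_productZ card_F quad2P quad1P) // ltnW.
Qed.

Lemma sum_codeword_isotropic m : \dim m = 2%N -> totally_isotropic form m ->
  \sum_(v in m) codeword v = 0.
Proof.
move=> /dim2_basis[u [v [fr ->]]] /orthovP ti.
rewrite (sum_line_digit_product card_F quad2P quad1P (ltnW n_gt1)) //.
by rewrite ti ?memv_span ?inE ?eqxx ?orbT // expr1 mul0r.
Qed.

Lemma sum_grid_functional_hyperbolic (u v u' v' : V) :
  symplectic_basis form u v u' v' ->
  \sum_(w in <<[:: u; v]>>%VS) grid_functional w = pol1 u v + pol1 u v ^+ 2.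
Proof.
move=> sb'; have [uv _ _] := sb'.
rewrite big_split /= !(sum_line_digit_product card_F quad1P quad2P) //;
  try exact: free_hyperbolic sb'; last exact: ltnW.
by rewrite uv !expr1n !mulr1 expr1.
Qed.

(** At s a + t b + x c + y d, [quad1] is ts and [quad2] is ts + yx. For fixed s
and t, expanding (ts + yx)^i binomially and summing over x and y leaves only
the monomial (yx)^(q-1), which occurs for i = q-1 only. *)
Lemma sum_quad_powers i j : (i <= 2 ^ n - 1)%N ->
  \sum_v quad2 v ^+ i * quad1 v ^+ j =
  if i == (2 ^ n - 1)%N then (\sum_(x : F) x ^+ j) ^+ 2 else 0.
Proof.
move=> lei.
have pow0 k : (k < 2 ^ n - 1)%N -> \sum_(x : F) x ^+ k = 0.
  by move=> ltk; rewrite sum_pow_lt // card_F -subn1.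
have xyE k : \sum_(x : F) \sum_(y : F) (y * x) ^+ k = (\sum_(x : F) x ^+ k) ^+ 2.
  rewrite expr2 mulr_suml; apply: eq_bigr => x _; rewrite mulr_sumr.
  by apply: eq_bigr => y _; rewrite exprMn mulrC.
have qE s t x y (v := s *: a + t *: b + (x *: c + y *: d)) :
    quad1 v = t * s /\ quad2 v = t * s + y * x.
  have := comb4K char2 form_alt sb (s, t, (x, y)).
  by rewrite /quad2 /quad1 /coord4 /comb4 /= -/v => -[-> -> -> ->].
transitivity (\sum_(s : F) \sum_(t : F)
    (t * s) ^+ j * \sum_(x : F) \sum_(y : F) (t * s + y * x) ^+ i).
  rewrite (sum_comb4 char2 form_alt sb).
  apply: eq_bigr => s _; apply: eq_bigr => t _; rewrite mulr_sumr.
  apply: eq_bigr => x _; rewrite mulr_sumr; apply: eq_bigr => y _.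
  by have [-> ->] := qE s t x y; rewrite mulrC.
have inner z : \sum_(x : F) \sum_(y : F) (z + y * x) ^+ i =
    if i == (2 ^ n - 1)%N then 1 else 0.
  transitivity (\sum_(k < i.+1) z ^+ (i - k) *+ 'C(i, k) *
      (\sum_(x : F) x ^+ k) ^+ 2).
    transitivity (\sum_(x : F) \sum_(k < i.+1) \sum_(y : F)
        z ^+ (i - k) *+ 'C(i, k) * (y * x) ^+ k).
      apply: eq_bigr => x _; rewrite exchange_big /=; apply: eq_bigr => y _.
      by rewrite exprDn; apply: eq_bigr => k _; rewrite mulrnAl.
    rewrite exchange_big /=; apply: eq_bigr => k _; rewrite -xyE mulr_sumr.
    by apply: eq_bigr => x _; rewrite mulr_sumr.
  rewrite big_ord_recr /= subnn expr0 binn mul1r big1 ?add0r => [|k _].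
    case: eqP => [->|/eqP i_neq]; last by rewrite pow0 ?expr0n // ltn_neqAle i_neq.
    by rewrite subn1 -card_F sum_pow_card1 sqrrN expr1n.
  by rewrite pow0 ?expr0n ?mulr0 // (leq_trans (ltn_ord k)).
under eq_bigr => s _ do under eq_bigr => t _ do rewrite inner.
case: eqP => _; last first.
  by rewrite big1 // => s _; rewrite big1 // => t _; rewrite mulr0.
by rewrite -xyE; apply: eq_bigr => s _; apply: eq_bigr => t _; rewrite mulr1.
Qed.

Lemma sum_grid_functional_codeword :
  \sum_v grid_functional v * codeword v = 1.
Proof.
transitivity (\sum_v (quad2 v ^+ (2 ^ n - 1) * quad1 v ^+ (2 ^ n - 1)
                    + quad2 v ^+ (2 ^ n - 2) * quad1 v ^+ (2 ^ n))).
  apply: eq_bigr => v _; rewrite /grid_functional /codeword /digit_product.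
  rewrite !expr1 expn1.
  set A := quad1 v; set B := quad2 v.
  have -> : (2 ^ n - 1 - 2 ^ 0 = 2 ^ n - 2)%N by lia.
  have -> : (2 ^ n - 1 = (2 ^ n - 2).+1)%N by lia.
  have -> : ((2 ^ n - 2).+1 - 2 = 2 ^ n - 3)%N by lia.
  rewrite ![_ ^+ (2 ^ n - 2).+1]exprS.
  have -> : A ^+ (2 ^ n) = A ^+ (2 ^ n - 2) * A ^+ 2.
    by rewrite -exprD subnK // ltnW.
  have -> : B ^+ (2 ^ n - 2) = B ^+ (2 ^ n - 3) * B.
    by rewrite -exprSr; congr (_ ^+ _); lia.
  by set A' := A ^+ (_ - _); set B' := B ^+ (_ - _); ring.
rewrite big_split /= !sum_quad_powers ?eqxx //; last by lia.
rewrite [X in if X then _ else _](_ : _ = false); last by apply/eqP; lia.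
by rewrite subn1 -card_F sum_pow_card1 sqrrN expr1n addr0.
Qed.

Hypothesis form_nondeg : nondegenerate form.

(** The values of p = [pol1] on the line and on its orthogonal add up to 1, by
expanding <a, b> in a symplectic basis adapted to the two lines, and
p + p^2 takes the same value at p and at 1 + p. *)
Lemma sum_grid_functional_orthov m : \dim m = 2%N -> ~~ totally_isotropic form m ->
  \sum_(v in m) grid_functional v = \sum_(v in orthov form m) grid_functional v.
Proof.
move=> dim_m /(hyperbolic_line char2 form_alt form_nondeg dim_m).
move=> [u [v [u' [v' [sb' ->]]]]].
rewrite (orthov_hyperbolic char2 form_alt sb').
rewrite (sum_grid_functional_hyperbolic sb').
rewrite (sum_grid_functional_hyperbolic (symplectic_basis_sym char2 sb')).
have [ab _ _] := sb.
have polD : pol1 u v + pol1 u' v' = 1.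
  rewrite -ab (form_expansion char2 form_alt sb' a b) /pol1.
  rewrite ![form a _](formC2 form char2) ![form b _](formC2 form char2).
  by congr (_ + _); rewrite addrC [X in X + _]mulrC [X in _ + X]mulrC; ring.
have -> : pol1 u v = 1 + pol1 u' v'.
  by rewrite -polD -addrA (addrr_pchar2 char2) addr0.
have two : 1 + 1 = 0 :> F by rewrite (addrr_pchar2 char2).
apply/eqP; rewrite -subr_eq0; apply/eqP.
transitivity ((1 + 1) * (1 + pol1 u' v') : F); first by ring.
by rewrite two mul0r.
Qed.

End Functions.

(** * Submodules generated by an invariant family of sets *)

Lemma exists_hom (K : fieldType) (U W : vectType K) (h : U -> W) :
  linear h -> exists H : 'Hom(U, W), H =1 h.
Proof.
move=> h_lin; pose h' := HB.pack_for {linear U -> W} h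
  (GRing.isLinear.Build K U W *:%R h h_lin).
by exists (linfun h') => u; rewrite lfunE.
Qed.

Section GeneratedSubmodules.

Variables (T : finType) (G : {group {perm T}}).
Implicit Types (S : {set {set T}}) (A : {set T}).

Definition stable_family S :=
  forall s A, s \in G -> A \in S -> [set s x | x in A] \in S.

Lemma ffun_perm_is_linear (s : {perm T}) :
  linear (fun f : {ffun T -> ('F_2)^o} => ffun_perm f s).
Proof. by move=> k f h; apply/ffunP=> x; rewrite !ffunE. Qed.

Lemma ffun_perm_charfun (s : {perm T}) A :
  ffun_perm (charfun A) s = charfun [set s x | x in A].
Proof.
apply/ffunP=> x; rewrite !ffunE; congr (nat_of_bool _)%:R.
by rewrite -{2}[x](permKV s) (mem_imset _ _ perm_inj).
Qed.

(** The linear span of the characteristic functions of an invariant family is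
already a submodule. *)
Lemma generated_submodule_sub S (W : {vspace {ffun T -> ('F_2)^o}}) :
  stable_family S -> {in S, forall A, charfun A \in W} ->
  (generated_submodule G S <= W)%VS.
Proof.
move=> stS SW; pose U := <<[seq charfun A | A in S]>>%VS.
have SU : {in S, forall A, charfun A \in U}.
  by move=> A SA; apply/memv_span/imageP; exists A.
have subUW : (U <= W)%VS.
  by apply/span_subvP=> _ /imageP[A SA ->]; apply: SW.
apply: subv_trans subUW; have [_ _ minU] := generated_submoduleP G S.
apply: minU => //; apply/forall_inP=> s Gs; apply/forallP=> f; apply/implyP.
have [phi phiE] := exists_hom (ffun_perm_is_linear s).
suff /subvP sUU : (U <= phi @^-1: U)%VS.
  by move=> /sUU; rewrite -memv_preim phiE.
apply/span_subvP=> _ /imageP[A SA ->].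
by rewrite -memv_preim phiE ffun_perm_charfun SU ?stS.
Qed.

Lemma dotprod_charfun (f : {ffun T -> ('F_2)^o}) A :
  dotprod f (charfun A) = \sum_(x in A) f x.
Proof.
rewrite /dotprod [RHS]big_mkcond; apply: eq_bigr => x _; rewrite ffunE.
by case: (x \in A); rewrite ?mulr1 ?mulr0.
Qed.

Lemma mem_dual_generated S (f : {ffun T -> ('F_2)^o}) :
  stable_family S -> {in S, forall A, \sum_(x in A) f x = 0} ->
  f \in dual_code (generated_submodule G S).
Proof.
move=> stS f0; rewrite /dual_code mem_orthov_sym.
apply: generated_submodule_sub => // A SA.
rewrite mem_orthov1_sym mem_orthov1.
by rewrite /= dotprod_charfun f0.
Qed.

(** The code words are orthogonal to every vector-valued function that sums to 0
over the generating sets. *)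
Lemma generated_sum0 (L : vectType 'F_2) S (f : T -> L) d :
  stable_family S -> {in S, forall A, \sum_(x in A) f x = 0} ->
  d \in generated_submodule G S -> \sum_x (d x : 'F_2) *: f x = 0.
Proof.
move=> stS f0; pose phi (d : {ffun T -> ('F_2)^o}) := \sum_x (d x : 'F_2) *: f x.
have phi_lin : linear phi.
  move=> k u v; rewrite /phi scaler_sumr -big_split; apply: eq_bigr => x _ /=.
  by rewrite !ffunE scalerDl scalerA.
have [Phi PhiE] := exists_hom phi_lin.
suff /subvP sub : (generated_submodule G S <= lker Phi)%VS.
  by move=> /sub; rewrite memv_ker PhiE => /eqP.
apply: generated_submodule_sub => // A SA; rewrite memv_ker PhiE /phi.
apply/eqP; rewrite -[RHS](f0 A SA) [RHS]big_mkcond; apply: eq_bigr => x _.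
by rewrite ffunE; case: (x \in A); rewrite ?scale1r ?scale0r.
Qed.

(** Writing g in a basis of F over the prime field, each coordinate of g is
orthogonal to the generating sets in S1, hence lies in the code generated by S2,
to which f is orthogonal. *)
Lemma dual_generated_pairing (F : finFieldType) S1 S2 (f g : T -> F) :
  2 \in [pchar F] -> stable_family S1 -> stable_family S2 ->
  {in S1, forall A, \sum_(x in A) g x = 0} ->
  {in S2, forall A, \sum_(x in A) f x = 0} ->
  generated_submodule G S2 = dual_code (generated_submodule G S1) ->
  \sum_x f x * g x = 0.
Proof.
move=> char2 st1 st2 g0 f0 eq_codes; pose L := pPrimeCharType char2.
pose e := vbasis {:L}; pose co i (y : L) : 'F_2 := coord e i y.
have gE x : g x = \sum_i co i (g x) *: (e`_i : L) by rewrite -coord_vbasis ?memvf.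
have swap (k : 'F_2) (u v : L) : u * (k *: v) = v * (k *: u).
  by rewrite -!scalerAr mulrC.
transitivity (\sum_(i < \dim {:L}) (e`_i : L) * (\sum_x co i (g x) *: (f x : L))).
  under eq_bigr => x _ do rewrite gE mulr_sumr.
  rewrite exchange_big /=; apply: eq_bigr => i _; rewrite mulr_sumr.
  by apply: eq_bigr => x _; apply: swap.
rewrite big1 // => i _; pose d : {ffun T -> ('F_2)^o} := [ffun x => co i (g x)].
have d_dual : d \in generated_submodule G S2.
  rewrite eq_codes; apply: mem_dual_generated => // A SA.
  under eq_bigr => x _ do rewrite ffunE.
  by rewrite /co -linear_sum /= (g0 A SA) linear0.
have := @generated_sum0 L S2 f d st2 f0 d_dual.
under eq_bigr => x _ do rewrite ffunE.
by move=> ->; rewrite mulr0.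
Qed.

End GeneratedSubmodules.

(** * Invariance of the lines and of the dual grids *)

Section PSp4Action.

Variables (F : finFieldType) (form : {skew_symmetric 'rV[F]_4}).
Implicit Types (g : {'GL_4[F]}) (m : {vspace 'rV[F]_4}).

Lemma image_points_of g m :
  [set actperm (point_action F) g p | p in points_of m]
  = points_of (mx_lfun g @: m)%VS.
Proof.
apply/setP=> p; rewrite -[p](permKV (actperm (point_action F) g)).
rewrite (mem_imset _ _ perm_inj) !inE actpermE /=.
by rewrite limg_ker0 ?lker_mx_lfun.
Qed.

Lemma dim_mx_lfun g m : \dim (mx_lfun g @: m) = \dim m.
Proof. by rewrite limg_dim_eq // lker_mx_lfun capv0. Qed.

Lemma orthov_mx_lfun g m : g \in Sp4 form ->
  orthov form (mx_lfun g @: m) = (mx_lfun g @: orthov form m)%VS.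
Proof.
rewrite inE => /'forall_'forall_eqP formg; apply/vspaceP=> w.
have /memv_imgP[{}w _ ->] : w \in limg (mx_lfun g).
  by rewrite lker0_limgf ?memvf ?lker_mx_lfun.
rewrite [RHS]memvE -limg_line limg_ker0 ?lker_mx_lfun // -memvE.
apply/mem_orthovP/mem_orthovP => [ow v mv|ow _ /memv_imgP[v mv ->]].
  by have := ow _ (memv_img (mx_lfun g) mv); rewrite !mx_lfunE formg.
by rewrite !mx_lfunE formg ow.
Qed.

Lemma totally_isotropic_mx_lfun g m : g \in Sp4 form ->
  totally_isotropic form (mx_lfun g @: m)%VS = totally_isotropic form m.
Proof.
by move=> Sg; rewrite /totally_isotropic orthov_mx_lfun // limg_ker0 ?lker_mx_lfun.
Qed.

Lemma PSp4P s : s \in PSp4 form ->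
  exists2 g, g \in Sp4 form & s = actperm (point_action F) g.
Proof. by move=> /morphimP[g _ Sg ->]; exists g. Qed.

Lemma stable_W_lines : stable_family (PSp4 form) (W_lines form).
Proof.
move=> s A /PSp4P[g Sg ->] /imsetP[m + ->]; rewrite inE => /andP[dim_m ti_m].
rewrite image_points_of; apply: imset_f.
by rewrite inE dim_mx_lfun dim_m totally_isotropic_mx_lfun.
Qed.

Lemma stable_dual_grids : stable_family (PSp4 form) (dual_grids form).
Proof.
move=> s A /PSp4P[g Sg ->] /imsetP[m + ->]; rewrite inE => /andP[dim_m ti_m].
rewrite imsetU !image_points_of -orthov_mx_lfun //; apply/imsetP.
by exists (mx_lfun g @: m)%VS; rewrite // inE dim_mx_lfun dim_m
  totally_isotropic_mx_lfun.
Qed.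

End PSp4Action.

(** * The two codes *)

Section Codes.

Variables (n : nat) (F : finFieldType) (form : {skew_symmetric 'rV[F]_4}).
Hypotheses (card_F : #|F| = (2 ^ n)%N) (q_gt2 : (2 < 2 ^ n)%N).
Hypothesis form_alt : forall u, form u u = 0.
Hypothesis form_nondeg : nondegenerate form.
Local Notation V := 'rV[F]_4.

Let char2 : 2 \in [pchar F].
Proof. by apply: card_finPcharP card_F _. Qed.

(** The number of points is odd for a nonzero subspace: the q^d - 1 nonzero
vectors are grouped by q-1. *)
Lemma card_points_of (U : {vspace V}) : #|points_of U|%:R = (U != 0%VS)%:R :> F.
Proof.
pose h (v : V) : F := (v != 0)%:R.
transitivity (\sum_(v in U) h v).
  rewrite -(sum_points_of _ char2) /h ?eqxx // => [|c v nzc]; last first.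
    by rewrite scaler_eq0 negb_or nzc.
  rewrite -sumr_const; apply: eq_bigr => p _.
  by rewrite vpick0 -dimv_eq0 (eqP (valP p)).
have -> : \sum_(v in U) h v = \sum_(v in U) 1 - 1.
  rewrite [X in X - _](bigD1 0) ?mem0v //= [LHS](bigD1 0) ?mem0v //= {1}/h eqxx.
  rewrite [RHS]addrC addKr add0r.
  by apply: eq_bigr => v /andP[_ nzv]; rewrite /h nzv.
rewrite sumr_const card_vspace natrX card_field_eq0 -dimv_eq0.
by case: (\dim U) => [|k]; rewrite ?subrr // exprS mul0r sub0r (oppr_pchar2 char2).
Qed.

Lemma points_of_cap (U W : {vspace V}) :
  points_of (U :&: W) = points_of U :&: points_of W.
Proof. by apply/setP=> p; rewrite !inE subv_cap. Qed.

Lemma disjoint_dual_grid m : \dim m = 2%N -> ~~ totally_isotropic form m ->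
  [disjoint points_of m & points_of (orthov form m)].
Proof.
move=> dim_m nti_m; rewrite -setI_eq0 -points_of_cap.
rewrite (capv_orthov_hyperbolic char2 form_alt form_nondeg dim_m nti_m).
by apply/eqP/setP=> p; rewrite !inE subv0 -dimv_eq0 (eqP (valP p)).
Qed.

Lemma even_line_grid l m : \dim l = 2%N -> totally_isotropic form l ->
  \dim m = 2%N -> ~~ totally_isotropic form m ->
  ~~ odd #|points_of l :&: (points_of m :|: points_of (orthov form m))|.
Proof.
move=> dim_l ti_l dim_m nti_m.
rewrite setIUr cardsU.
set X := points_of l :&: _; set Y := points_of l :&: _.
have -> : X :&: Y = set0.
  apply/eqP; rewrite setI_eq0.
  apply: disjointWl (subsetIr _ _) (disjointWr (subsetIr _ _) _).
  exact: disjoint_dual_grid.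
rewrite cards0 subn0 -dvdn2 (dvdn_pcharf char2) natrD /X /Y -!points_of_cap !card_points_of.
rewrite (isotropic_line_meets_both char2 form_alt form_nondeg dim_l ti_l dim_m nti_m).
by rewrite (addrr_pchar2 char2).
Qed.

Lemma dual_grid_code_sub :
  (dual_grid_code form <= dual_code (line_code form))%VS.
Proof.
apply: generated_submodule_sub => [|A /imsetP[m + ->]]; first exact: stable_dual_grids.
rewrite inE => /andP[/eqP dim_m nti_m].
apply: mem_dual_generated => [|B /imsetP[l + ->]]; first exact: stable_W_lines.
rewrite inE => /andP[/eqP dim_l ti_l].
under eq_bigr => p _ do rewrite ffunE.
pose grid := points_of m :|: points_of (orthov form m).
have -> : \sum_(p in points_of l) (p \in grid)%:R = #|points_of l :&: grid|%:R :> 'F_2.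
  rewrite -sum1_card natr_sum big_mkcond [RHS]big_mkcond.
  apply: eq_bigr => p _; rewrite in_setI.
  by case: (p \in points_of l) => //=; case: (p \in grid).
apply/eqP; rewrite -(dvdn_pcharf (pchar_Fp _)) // dvdn2.
exact: even_line_grid.
Qed.

Lemma dual_grid_code_neq : dual_grid_code form <> dual_code (line_code form).
Proof.
have [a [b [c [d sb]]]] := exists_symplectic_basis char2 form_alt form_nondeg.
pose f (p : point F) := grid_functional n form a b c d (vpick (val p)).
pose g (p : point F) := codeword n form a b c d (vpick (val p)).
have f0 := grid_functional0 n form a b c d.
have fZ := grid_functionalZ card_F q_gt2 form_alt sb.
have g0 := codeword0 card_F form_alt sb.
have gZ := codewordZ card_F q_gt2 form_alt sb.
move=> eq_codes.
have := dual_generated_pairing (f := f) (g := g) char2 (@stable_W_lines _ form)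
  (@stable_dual_grids _ form) _ _ eq_codes.
have -> : \sum_p f p * g p = 1.
  rewrite -(sum_grid_functional_codeword card_F q_gt2 form_alt sb).
  pose h v := grid_functional n form a b c d v * codeword n form a b c d v.
  have h0 : h 0 = 0 by rewrite /h f0 mul0r.
  have hZ k v : k != 0 -> h (k *: v) = h v by move=> nzk; rewrite /h fZ // gZ.
  transitivity (\sum_(p in points_of {:V}) h (vpick (val p))).
    by apply: eq_bigl => p; rewrite inE subvf.
  by rewrite (sum_points_of _ char2 h0 hZ); apply: eq_bigl => v; rewrite memvf.
move=> pairing0; have := oner_neq0 F; rewrite pairing0 ?eqxx //.
  move=> A /imsetP[m + ->]; rewrite inE => /andP[/eqP dim_m ti_m].
  by rewrite (sum_points_of _ char2) // (sum_codeword_isotropic card_F q_gt2 _ sb).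
move=> A /imsetP[m + ->]; rewrite inE => /andP[/eqP dim_m nti_m].
rewrite (eq_bigl [predU points_of m & points_of (orthov form m)]); last first.
  by move=> p; rewrite inE.
rewrite bigU ?disjoint_dual_grid //= !(sum_points_of _ char2) //.
rewrite (sum_grid_functional_orthov card_F q_gt2 form_alt sb form_nondeg) //.
by rewrite (addrr_pchar2 char2).
Qed.

End Codes.

Theorem corollary1p3 (n : nat) (F : finFieldType)
    (card_F : #|F| = (2 ^ n)%N) (q_gt2 : (2 < 2 ^ n)%N)
    (form : {skew_symmetric 'rV[F]_4}) (symplectic_form : is_psymplectic form) :
  (dual_grid_code form <= dual_code (line_code form))%VS
  /\ dual_grid_code form <> dual_code (line_code form).
Proof.
have [form_nondeg _ alt] := symplectic_form.
have form_alt u : form u u = 0 by apply: alt; apply: card_finPcharP card_F _.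
split; first exact: dual_grid_code_sub card_F form_alt form_nondeg.
exact: dual_grid_code_neq card_F q_gt2 form_alt form_nondeg.
Qed.
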